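(* Let $(V,\#,\ast)$ and $(W,\#',\ast')$ be two hypervector spaces over the same hyperfield $(F,\oplus,.)$ and let $T:V\to W$ be a linear transformation. Let $A=\{(a,\mu_F(a),\nu_F(a)):a\in F\}$ be an intuitionistic fuzzy hyperfield on $F$ and let $B=\{(y,\mu_W(y),\nu_W(y)):y\in W\}$ be an intuitionistic fuzzy hypervector space of $W$ over $A$. Then $$T^{-1}(B)=\{(x,\ T^{-1}(\mu_W)(x),\ T^{-1}(\nu_W)(x)):x\in V\}$$ is an intuitionistic fuzzy hypervector space of $V$ over $A$.
   Context: Notation: $\wedge,\bigwedge$ denote minimum/infimum and $\vee,\bigvee$ denote maximum/supremum in $[0,1]$. For a map $f:X\to Y$ and a function $\nu:Y\to[0,1]$, $f^{-1}(\nu):X\to[0,1]$ is defined by $f^{-1}(\nu)(x)=\nu(f(x))$. A hyperoperation on a nonempty set $X$ is a map $\#$ from $X\times X$ to the set of nonempty subsets of $X$. Hyperoperations are extended to subsets by taking unions, e.g. $x\# S=\bigcup_{s\in S}x\# s$ and $S\# S'=\bigcup_{s\in S,s'\in S'}s\# s'$. A hypergroup is a nonempty set $X$ with a hyperoperation $\#$ such that: $x\#(y\# z)=(x\# y)\# z$; there is $0\in X$ such that for every $a\in X$ there is a unique $b\in X$ with $0\in a\# b$ and $0\in b\# a$ (this $b$ is denoted $-a$); and for all $a,b,c\in X$, $a\in b\# c$ implies $b\in a\#(-c)$. It is commutative if $x\# y=y\# x$ for all $x,y$. A hyperring $(X,\oplus,.)$ is a nonempty set with a hyperaddition $\oplus$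 making it a commutative hypergroup and a single-valued multiplication making it a semigroup, the multiplication being distributive over $\oplus$ from the left and from the right, and $a.0=0.a=0$ for all $a$. A hyperfield is a hyperring with an element $1$ (the identity) such that $a.1=a$ for all $a$, such that each nonzero $a$ has an element $a^{-1}$ with $a.a^{-1}=1$, and with $a.b=b.a$ for all $a,b$. A hypervector space over a hyperfield $(F,\oplus,.)$ is an additive commutative hypergroup $(V,\#)$ (with zero element $\theta$, called the null vector) together with a map $\ast$ from $F\times V$ to the nonempty subsets of $V$ (with $a\ast S=\bigcup_{s\in S}a\ast s$) such that for all $a,b\in F$, $\alpha,\beta\in V$: $a\ast(\alpha\#\beta)\subseteq a\ast\alpha\,\#\,a\ast\beta$; $(a\oplus b)\ast\alpha\subseteq a\ast\alpha\,\#\,b\ast\alpha$; $(a.b)\ast\alpha=a\ast(b\ast\alpha)$; $(-a)\ast\alpha=a\ast(-\alpha)$; $\alpha\in 1\ast\alpha$, $\theta\in 0\ast\alpha$ and $0\ast\theta=\{\theta\}$. A map $T:V\to W$ between hypervector spaces $(V,\#,\ast)$ and $(W,\#',\ast')$ over the same hyperfield $F$, with null vectors $\theta$ and $\theta'$, is a linear transformation if for all $x,y\in V$, $a\in F$: $T(x\# y)\subseteq T(x)\,\#'\,T(y)$; $T(a\ast x)\subseteq a\ast' T(x)$; and $T(\theta)=\theta'$ (here $T$ of a subset is its image). An intuitionistic fuzzy set of a set $E$ is an object $\{(x,\mu(x),\nu(x)):x\in E\}$ with $\mu,\nu:E\to[0,1]$ and $0\le\mu(x)+\nu(x)\le1$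 for all $x\in E$. An intuitionistic fuzzy hyperfield on $F$ is an intuitionistic fuzzy set $\{(a,\mu_F(a),\nu_F(a)):a\in F\}$ such that for all $a,b\in F$: $\bigwedge_{x\in a\oplus b}\mu_F(x)\ge\mu_F(a)\wedge\mu_F(b)$; $\mu_F(-a)\ge\mu_F(a)$; $\mu_F(a.b)\ge\mu_F(a)\wedge\mu_F(b)$; $\mu_F(a^{-1})\ge\mu_F(a)$ if $a\ne0$; $\bigvee_{x\in a\oplus b}\nu_F(x)\le\nu_F(a)\vee\nu_F(b)$; $\nu_F(-a)\le\nu_F(a)$; $\nu_F(a.b)\le\nu_F(a)\vee\nu_F(b)$; $\nu_F(a^{-1})\le\nu_F(a)$ if $a\ne0$. Given an intuitionistic fuzzy hyperfield $A=\{(a,\mu_F(a),\nu_F(a)):a\in F\}$ on $F$, an intuitionistic fuzzy set $B=\{(x,\mu_V(x),\nu_V(x)):x\in V\}$ of a hypervector space $V$ over $F$ is an intuitionistic fuzzy hypervector space (of $V$) over $A$ if for all $x,y\in V$, $a\in F$: $\bigwedge_{\alpha\in x\# y}\mu_V(\alpha)\ge\mu_V(x)\wedge\mu_V(y)$; $\mu_V(-x)\ge\mu_V(x)$; $\bigwedge_{y\in a\ast x}\mu_V(y)\ge\mu_V(x)\wedge\mu_F(a)$; $\mu_F(1)\ge\mu_V(\theta)$; $\bigvee_{\alpha\in x\# y}\nu_V(\alpha)\le\nu_V(x)\vee\nu_V(y)$; $\nu_V(-x)\le\nu_V(x)$; $\bigvee_{y\in a\ast x}\nu_V(y)\le\nu_V(x)\vee\nu_F(a)$;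 $\nu_F(1)\le\nu_V(\theta)$. *)

(* Defs.v *)
From HB Require Import structures.
From mathcomp Require Import all_boot all_order all_algebra.
From mathcomp Require Import boolp classical_sets reals.

Set Implicit Arguments.
Unset Strict Implicit.
Unset Printing Implicit Defensive.

Import Order.TTheory GRing.Theory Num.Theory.

Local Open Scope classical_set_scope.
Local Open Scope ring_scope.

Definition setop (X Y Z : Type) (op : X -> Y -> set Z) (A : set X) (B : set Y)
  : set Z := \bigcup_(a in A) \bigcup_(b in B) op a b.

(* The opposite is carried as an operation: [hoppP] says that [hopp a] is the
   unique [b] such that [hzero] belongs to both [hadd a b] and [hadd b a].
   Nonemptiness of the carrier is witnessed by [hzero]. *)
HB.mixin Record isHypergroup X := {
  hadd : X -> X -> set X;
  hzero : X;
  hopp : X -> X;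
  hadd_neq0 : forall x y, hadd x y !=set0;
  haddA : forall x y z,
    \bigcup_(s in hadd y z) hadd x s = \bigcup_(s in hadd x y) hadd s z;
  hoppP : forall a b, hadd a b hzero /\ hadd b a hzero <-> b = hopp a;
  hadd_rev : forall a b c, hadd b c a -> hadd a (hopp c) b
}.

#[short(type="hypergroupType")]
HB.structure Definition Hypergroup := {X of isHypergroup X}.

HB.mixin Record Hypergroup_isCommutative X of Hypergroup X := {
  haddC : forall x y : X, hadd x y = hadd y x
}.

#[short(type="comHypergroupType")]
HB.structure Definition ComHypergroup :=
  {X of Hypergroup X & Hypergroup_isCommutative X}.

HB.mixin Record ComHypergroup_isHyperring X of ComHypergroup X := {
  hmul : X -> X -> X;
  hmulA : forall a b c, hmul a (hmul b c) = hmul (hmul a b) c;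
  hmulDr : forall a b c : X,
    [set hmul a s | s in hadd b c] = hadd (hmul a b) (hmul a c);
  hmulDl : forall a b c : X,
    [set hmul s c | s in hadd a b] = hadd (hmul a c) (hmul b c);
  hmulr0 : forall a, hmul a hzero = hzero;
  hmul0r : forall a, hmul hzero a = hzero
}.

#[short(type="hyperringType")]
HB.structure Definition Hyperring :=
  {X of ComHypergroup X & ComHypergroup_isHyperring X}.

(* [hinv hzero] is unconstrained and is never used. *)
HB.mixin Record Hyperring_isHyperfield F of Hyperring F := {
  hone : F;
  hinv : F -> F;
  hmulr1 : forall a : F, hmul a hone = a;
  hmulrV : forall a : F, a <> hzero -> hmul a (hinv a) = hone;
  hmulC : forall a b : F, hmul a b = hmul b a
}.

#[short(type="hyperfieldType")]
HB.structure Definition Hyperfield :=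
  {F of Hyperring F & Hyperring_isHyperfield F}.

HB.mixin Record ComHypergroup_isHypervectorSpace (F : hyperfieldType) V
    of ComHypergroup V := {
  hscale : F -> V -> set V;
  hscale_neq0 : forall a x, hscale a x !=set0;
  hscaleDr : forall (a : F) (x y : V),
    \bigcup_(s in hadd x y) hscale a s
      `<=` setop hadd (hscale a x) (hscale a y);
  hscaleDl : forall (a b : F) (x : V),
    \bigcup_(c in hadd a b) hscale c x
      `<=` setop hadd (hscale a x) (hscale b x);
  hscaleA : forall (a b : F) (x : V),
    hscale (hmul a b) x = \bigcup_(s in hscale b x) hscale a s;
  hscaleN : forall (a : F) (x : V), hscale (hopp a) x = hscale a (hopp x);
  hscale1 : forall x : V, hscale hone x x;
  hscale0 : forall x : V, hscale hzero x hzero;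
  hscale00 : hscale hzero hzero = [set hzero]
}.

#[short(type="hvectType")]
HB.structure Definition HypervectorSpace (F : hyperfieldType) :=
  {V of ComHypergroup V & ComHypergroup_isHypervectorSpace F V}.

Record linear_transformation (F : hyperfieldType) (V W : hvectType F)
    (T : V -> W) : Prop := LinearTransformation {
  lt_add : forall x y : V, T @` hadd x y `<=` hadd (T x) (T y);
  lt_scale : forall (a : F) (x : V), T @` hscale a x `<=` hscale a (T x);
  lt_zero : T hzero = hzero
}.

(* A pair of candidate membership and non-membership functions; the conditions
   making it an intuitionistic fuzzy set are in [is_ifset]. *)
Record ifpair (R : realType) (E : Type) := IFPair {
  mu : E -> R;
  nu : E -> R
}.

Record is_ifset (R : realType) (E : Type) (A : ifpair R E) : Prop := IsIFSet {
  mu_01 : forall x, 0 <= mu A x <= 1;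
  nu_01 : forall x, 0 <= nu A x <= 1;
  munu_01 : forall x, 0 <= mu A x + nu A x <= 1
}.

Definition ifpreimage (R : realType) (X Y : Type) (f : X -> Y)
  (B : ifpair R Y) : ifpair R X := IFPair (mu B \o f) (nu B \o f).

(* The sets over which [inf] and [sup] are taken below are nonempty and, for an
   intuitionistic fuzzy set, included in [0, 1], so that these are the genuine
   infimum and supremum. *)
Record is_ifhyperfield (R : realType) (F : hyperfieldType) (A : ifpair R F)
    : Prop := IsIFHyperfield {
  ifhf_ifset : is_ifset A;
  ifhf_muD : forall a b : F,
    Num.min (mu A a) (mu A b) <= inf [set mu A x | x in hadd a b];
  ifhf_muN : forall a : F, mu A a <= mu A (hopp a);
  ifhf_muM : forall a b : F, Num.min (mu A a) (mu A b) <= mu A (hmul a b);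
  ifhf_muV : forall a : F, a <> hzero -> mu A a <= mu A (hinv a);
  ifhf_nuD : forall a b : F,
    sup [set nu A x | x in hadd a b] <= Num.max (nu A a) (nu A b);
  ifhf_nuN : forall a : F, nu A (hopp a) <= nu A a;
  ifhf_nuM : forall a b : F, nu A (hmul a b) <= Num.max (nu A a) (nu A b);
  ifhf_nuV : forall a : F, a <> hzero -> nu A (hinv a) <= nu A a
}.

Record is_ifhvect (R : realType) (F : hyperfieldType) (A : ifpair R F)
    (V : hvectType F) (B : ifpair R V) : Prop := IsIFHVect {
  ifhv_ifset : is_ifset B;
  ifhv_muD : forall x y : V,
    Num.min (mu B x) (mu B y) <= inf [set mu B z | z in hadd x y];
  ifhv_muN : forall x : V, mu B x <= mu B (hopp x);
  ifhv_muZ : forall (a : F) (x : V),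
    Num.min (mu B x) (mu A a) <= inf [set mu B y | y in hscale a x];
  ifhv_mu1 : mu B hzero <= mu A hone;
  ifhv_nuD : forall x y : V,
    sup [set nu B z | z in hadd x y] <= Num.max (nu B x) (nu B y);
  ifhv_nuN : forall x : V, nu B (hopp x) <= nu B x;
  ifhv_nuZ : forall (a : F) (x : V),
    sup [set nu B y | y in hscale a x] <= Num.max (nu B x) (nu A a);
  ifhv_nu1 : nu A hone <= nu B hzero
}.

(* Main.v *)
Require Import Defs.
From mathcomp Require Import all_boot all_order all_algebra.
From mathcomp Require Import classical_sets reals.

(** Every condition on the pulled back pair is the condition on [B] read at
    image points.  Since [T] only sends a sum [hadd x y] or a scalar multiple
    [hscale a x] into the corresponding set of [W], the values of [mu B \o T]
    on the former are among the values of [mu B] on the latter; an infimum can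
    only grow, and a supremum only shrink, when the set becomes smaller
    ([le_inf_comp], [sup_comp_le]).  The conditions on opposites and on the null
    vector need exact equalities: [T] preserves the null vector by definition,
    and hence preserves opposites because these are unique
    ([linear_transformation_opp]). *)

Import Order.TTheory GRing.Theory Num.Theory.
Local Open Scope classical_set_scope.
Local Open Scope ring_scope.

(** Nonemptiness of [S] and boundedness of [g] matter here because [inf] and
    [sup] take a default value on sets that are empty or unbounded. *)
Lemma le_inf_comp (R : realType) (X Y : Type) (f : X -> Y) (g : Y -> R)
    (S : set X) (S' : set Y) (l m : R) :
  S !=set0 -> f @` S `<=` S' -> (forall y, l <= g y) ->
  m <= inf (g @` S') -> m <= inf ((g \o f) @` S).
Proof.
move=> S0 fS lg mS'; apply: lb_le_inf; first exact: image_nonempty.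
move=> _ [x Sx <-]; apply: (le_trans mS'); apply: ge_inf.
  by exists l => _ [y _ <-].
by exists (f x) => //; apply: fS; exists x.
Qed.

Lemma sup_comp_le (R : realType) (X Y : Type) (f : X -> Y) (g : Y -> R)
    (S : set X) (S' : set Y) (u m : R) :
  S !=set0 -> f @` S `<=` S' -> (forall y, g y <= u) ->
  sup (g @` S') <= m -> sup ((g \o f) @` S) <= m.
Proof.
move=> S0 fS gu S'm; apply: ge_sup; first exact: image_nonempty.
move=> _ [x Sx <-]; apply: le_trans S'm; apply: ub_le_sup.
  by exists u => _ [y _ <-].
by exists (f x) => //; apply: fS; exists x.
Qed.

(** The null vector lies in [hadd x (hopp x)], so its image, again the null
    vector, lies in [hadd (T x) (T (hopp x))]; uniqueness of the opposite of
    [T x] concludes. *)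
Lemma linear_transformation_opp (F : hyperfieldType) (V W : hvectType F)
    (T : V -> W) (x : V) :
  linear_transformation T -> T (hopp x) = hopp (T x).
Proof.
move=> linT; have [x0 _] : hadd x (hopp x) hzero /\ hadd (hopp x) x hzero.
  exact/hoppP.
have Tx0 : hadd (T x) (T (hopp x)) hzero.
  by rewrite -(lt_zero linT); apply: (lt_add linT); exists hzero.
by apply/hoppP; split; rewrite // haddC.
Qed.

Lemma is_ifset_preimage (R : realType) (X Y : Type) (f : X -> Y)
    (B : ifpair R Y) :
  is_ifset B -> is_ifset (ifpreimage f B).
Proof. by case=> mu01 nu01 munu01; split=> x /=. Qed.

Theorem theorem4p2 (R : realType) (F : hyperfieldType) (V W : hvectType F)
  (T : V -> W) (A : ifpair R F) (B : ifpair R W) :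
  linear_transformation T ->
  is_ifhyperfield A ->
  is_ifhvect A B ->
  is_ifhvect A (ifpreimage T B).
Proof.
move=> linT _ [ifB muD muN muZ mu1 nuD nuN nuZ nu1].
have mu_ge0 y : 0 <= mu B y by case/andP: (mu_01 ifB y).
have nu_le1 y : nu B y <= 1 by case/andP: (nu_01 ifB y).
split; first exact: is_ifset_preimage.
- move=> x y; apply: le_inf_comp mu_ge0 (muD _ _); first exact: hadd_neq0.
  exact: lt_add.
- by move=> x /=; rewrite linear_transformation_opp.
- move=> a x; apply: le_inf_comp mu_ge0 (muZ _ _); first exact: hscale_neq0.
  exact: lt_scale.
- by rewrite /= lt_zero.
- move=> x y; apply: sup_comp_le nu_le1 (nuD _ _); first exact: hadd_neq0.
  exact: lt_add.
- by move=> x /=; rewrite linear_transformation_opp.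
- move=> a x; apply: sup_comp_le nu_le1 (nuZ _ _); first exact: hscale_neq0.
  exact: lt_scale.
- by rewrite /= lt_zero.
Qed.
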